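(* Let $T_h$ be the complete binary tree of height $h$. Then $$P(T_h)\geq |V(T_h)|-172$$ for all $h\in\mathbb{N}$, where $P(T_h)$ denotes the pegging number of $T_h$.
   Context: A distribution $D$ of pegs on a graph $G$ is a subset of $V(G)$ (the vertices holding one peg each). A pegging move from $D$ to $D'$: there are distinct vertices $u,v\in D$ and $w\notin D$ with both $u$ and $w$ adjacent to $v$, and $D'=(D\setminus\{u,v\})\cup\{w\}$. A vertex $x$ is reachable from $D$ if some finite (possibly empty) sequence of pegging moves starting at $D$ yields a distribution containing $x$. The reach $R(D)$ is the set of vertices reachable from $D$; $G$ can be pegged by $D$ if $R(D)=V(G)$. The pegging number $P(G)$ is the smallest natural number such that $G$ can be pegged by every distribution of size $P(G)$. The complete binary tree $T_h$ of height $h$ is the rooted tree in which every vertex at distance less than $h$ from the root has exactly two children and the leaves are exactly the vertices at distance $h$ from the root. *)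

(* Defs.v *)
From mathcomp Require Import all_boot.

Set Implicit Arguments.
Unset Strict Implicit.
Unset Printing Implicit Defensive.

Section Pegging.

(* A finite graph is given by its adjacency relation [adj] on the finType [V];
   a distribution is a set of vertices. *)
Variables (V : finType) (adj : rel V).

Definition pegging_move : rel {set V} := fun D D' =>
  [exists u, exists v, exists w,
     [&& u != v, u \in D, v \in D, w \notin D, adj u v, adj w v
       & D' == w |: (D :\: [set u; v])]].

Definition reachable (D : {set V}) (x : V) : bool :=
  [exists D' : {set V}, connect pegging_move D D' && (x \in D')].

Definition reach (D : {set V}) : {set V} := [set x | reachable D x].

Definition can_be_pegged_by (D : {set V}) : bool := reach D == [set: V].

Definition pegged_by_all_of_size (n : nat) : bool :=
  [forall D : {set V}, (#|D| == n) ==> can_be_pegged_by D].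

Lemma pegged_by_all_of_some_size : exists n, pegged_by_all_of_size n.
Proof.
exists #|V|; apply/forallP=> D; apply/implyP=> /eqP cardD.
have -> : D = setT by apply/eqP; rewrite eqEcard subsetT cardsT cardD leqnn.
apply/eqP/setP=> x; rewrite !inE.
by apply/existsP; exists setT; rewrite connect0 inE.
Qed.

Definition pegging_number : nat := ex_minn pegged_by_all_of_some_size.

End Pegging.

(* The vertices of T_h are the boolean words of length at most h. The root is
   the empty word, the two children of a word w of length < h are
   [true :: w] and [false :: w]; so the distance to the root is the length. *)
Definition btree (h : nat) : finType := (h.-bseq bool : finType).

Definition btree_child (h : nat) (x y : btree h) : bool :=
  [exists b : bool, y == b :: x :> seq bool].

Definition btree_adj (h : nat) : rel (btree h) := fun x y =>
  btree_child x y || btree_child y x.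

Lemma btree_adj_sym h : symmetric (@btree_adj h).
Proof. by move=> x y; rewrite /btree_adj orbC. Qed.

Lemma btree_adj_irr h : irreflexive (@btree_adj h).
Proof.
move=> x; rewrite /btree_adj orbb; apply/existsP=> -[b /eqP/(congr1 size)] /=.
by move/eqP; rewrite -[X in X == _]addn0 -addn1 eqn_add2l.
Qed.

Lemma card_btree_children h (x : btree h) :
  #|[set y | btree_child x y]| = if size x < h then 2 else 0.
Proof.
case: ifPn => [ltxh | /negP gexh].
  have sz b : size (b :: x) <= h by [].
  rewrite -card_bool -(card_imset predT (f := fun b => Bseq (sz b))).
    apply: eq_card => y; rewrite inE; apply/existsP/imsetP.
      by case=> b /eqP def_y; exists b => //; apply: val_inj.
    by case=> b _ ->; exists b.
  by move=> b c /(congr1 val)[].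
apply: eq_card0 => y; rewrite inE; apply/existsP=> -[b /eqP def_y].
by apply: gexh; have := size_bseq y; rewrite def_y.
Qed.

Lemma btree_parent_unique h (y : btree h) :
  y != [::] :> seq bool -> exists! x, btree_child x y.
Proof.
case: y => -[//|b s] sz _ /=.
have szs : size s <= h by apply: ltnW.
exists (Bseq szs); split; first by apply/existsP; exists b.
by move=> x /existsP[c /eqP[_ def_x]]; apply: val_inj.
Qed.

(* Main.v *)
Require Import Defs.
From mathcomp Require Import all_boot.
From mathcomp Require Import all_order all_algebra ring lra zify.

Set Implicit Arguments.
Unset Strict Implicit.
Unset Printing Implicit Defensive.

Import Order.TTheory GRing.Theory Num.Theory.

(** Why the theorem holds.

A nonnegative function f on the vertices with f w <= f u + f v whenever a peg
on u can jump over v into w is a pagoda function (the device of Conway's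
soldiers): no move increases the total f-weight of the pegs.  Hence, if the
vertices of a set A weigh together less than a single vertex x, then x cannot
be reached from A, nor from any subset of A, and the pegging number exceeds
#|A| ([pagoda_lt_pegging_number]).  It remains to remove boundedly many
vertices from T_h so that what is left weighs less than some x.

The vertex x is a leaf, because few vertices are close to a leaf: there are
at most 2 ^ (d / 2) of them at distance d.  A pagoda function may decay like
phi ^ (- d), where phi = 1.618... is the golden ratio, and sqrt 2 < phi; so
the total weight of T_h is bounded independently of h, and a finite number of
holes around x suffices.

To be economical with holes the decay is refined.  Let x_k be the ancestor of
x at height k.  A vertex has coordinates (k, j) when it has height j and x_k is
its lowest common ancestor with x.  Within the branch that leaves the path at
x_k, the weight is a multiple [scale k] of the Fibonacci number F_j; this still
satisfies the pagoda inequalities, now with equality from the leaves upwards,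
and almost all leaves, half of the tree, weigh nothing and never need to be
holes.  Along the path the weight of x_k is scale k * F_k, which has to decay
like phi ^ (- k), so that [scale k] decays like phi ^ (- 2 k); the rational
ratio 5/13 is slightly more than phi ^ (- 2).  The 2 ^ (k - 1 - j) vertices
with coordinates (k, j), j < k, and x_k weigh together
scale k * (2 ^ k - F_(k+1)) ([shell_fib]), which is summable since
2 * 5/13 < 1.

With f x = 312, the 161 holes of [hole] leave a weight of about 304.97. *)

(** * Pagoda functions on a graph *)

Section Pagoda.

Variables (V : finType) (adj : rel V) (R : numDomainType) (f : V -> R).

Definition pagoda :=
  (forall v, 0 <= f v)%R /\
  (forall u v w, adj u v -> adj w v -> u != w -> f w <= f u + f v)%R.

Definition weight (D : {set V}) : R := (\sum_(v in D) f v)%R.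

Hypothesis f_pagoda : pagoda.

Lemma weight_sub (A B : {set V}) : A \subset B -> (weight A <= weight B)%R.
Proof.
move=> sAB; rewrite /weight [X in (_ <= X)%R](big_setID A) /= (setIidPr sAB).
by rewrite lerDl sumr_ge0 // => v _; case: f_pagoda.
Qed.

Lemma weight_move D D' : pegging_move adj D D' -> (weight D' <= weight D)%R.
Proof.
case/existsP=> u /existsP[v /existsP[w]].
case/and5P=> neq_uv uD vD wD /and3P[adj_uv adj_wv /eqP->].
have sub_uv : [set u; v] \subset D.
  by apply/subsetP=> y; rewrite !inE => /orP[]/eqP->.
rewrite /weight big_setU1 /=; last by rewrite !inE (negPf wD) andbF.
rewrite [X in (_ <= X)%R](big_setID [set u; v]) /= (setIidPr sub_uv) lerD2r.
rewrite big_setU1 ?inE //= big_set1.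
case: f_pagoda => _; apply=> //.
by apply: contraNneq wD => <-.
Qed.

Lemma reachable_weight D x : reachable adj D x -> (f x <= weight D)%R.
Proof.
case/existsP=> D' /andP[/connectP[p pth ->] xlast].
elim: p D pth xlast => [|E p IHp] D /=; last first.
  case/andP=> mv pth xlast; apply: le_trans (weight_move mv).
  exact: IHp pth xlast.
move=> _ xD; rewrite -[f x](big_set1 +%R x f).
by apply: weight_sub; rewrite sub1set.
Qed.

(** A distribution contained in A weighs at most as much as A, so A obstructs
pegging by distributions of every size up to #|A|, as is necessary to bound a
minimum from below. *)
Lemma pagoda_lt_pegging_number (A : {set V}) x :
  (weight A < f x)%R -> #|A| < pegging_number adj.
Proof.
move=> ltAx; rewrite /pegging_number; case: ex_minnP => n /forallP pegs_n _.
rewrite ltnNge; apply/negP => /card_geqP[s [uniq_s size_s sub_s]].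
have sDA : [set y in s] \subset A.
  by apply/subsetP=> y; rewrite inE => /sub_s.
have cardD : #|[set y in s]| == n by rewrite cardsE (card_uniqP uniq_s) size_s.
have /eqP/setP/(_ x) := implyP (pegs_n [set y in s]) cardD.
rewrite !inE => /reachable_weight le_fx.
by have := le_lt_trans (le_trans le_fx (weight_sub sDA)) ltAx; rewrite ltxx.
Qed.

End Pagoda.

(** * Summing over the complete binary tree *)

(** The words of length at most h are built from their root end, which is the
end of the list: this splits T_(h+1) into its root and two copies of T_h,
one of which contains the leaf x. *)
Fixpoint words h : seq (seq bool) :=
  if h is h'.+1 then
    [::] :: [seq rcons w true | w <- words h'] ++
            [seq rcons w false | w <- words h']
  else [:: [::]].

Lemma mem_words h w : (w \in words h) = (size w <= h).
Proof.
elim: h w => [|h IHh] w /=; first by rewrite inE; case: w.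
case/lastP: w => [|w b]; first by rewrite inE.
have rinj (c : bool) : injective (fun w => rcons w c).
  by move=> s1 s2 /rcons_inj[].
rewrite inE mem_cat size_rcons ltnS -IHh.
have -> : (rcons w b == [::]) = false by case: w.
have rF c : b != c -> (rcons w b \in [seq rcons w c | w <- words h]) = false.
  move=> ne; apply/mapP=> -[s _ /rcons_inj[_ eq_bc]].
  by rewrite eq_bc eqxx in ne.
case: b rF => rF; first by rewrite (rF false) // orbF (mem_map (rinj true)).
by rewrite (rF true) // (mem_map (rinj false)).
Qed.

Lemma uniq_words h : uniq (words h).
Proof.
elim: h => [//|h IHh] /=.
have rinj (c : bool) : injective (fun w => rcons w c).
  by move=> s1 s2 /rcons_inj[].
rewrite cat_uniq !map_inj_uniq // IHh /= andbT mem_cat negb_or.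
rewrite andbC; apply/andP; split; last first.
  by apply/andP; split; apply/mapP=> -[[|? ?] _].
by apply/hasPn=> _ /mapP[s _ ->]; apply/mapP=> -[s' _ /rcons_inj[]].
Qed.

Lemma big_btree (M : nmodType) h (F : seq bool -> M) :
  (\sum_(w : btree h) F w = \sum_(w <- words h) F w)%R.
Proof.
have -> : (\sum_(w : btree h) F w = 
           \sum_(w <- [seq val w | w <- index_enum (btree h)]) F w)%R.
  by rewrite big_map.
apply/perm_big/uniq_perm; rewrite ?uniq_words //.
  by rewrite map_inj_uniq ?index_enum_uniq //; apply: val_inj.
move=> w; rewrite mem_words; apply/mapP/idP => [[v _ ->]|szw].
  exact: size_bseq.
by exists (Bseq szw); rewrite ?mem_index_enum.
Qed.

(** The target leaf x is the word of h letters true.  The path from the root to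
w follows the path to x as long as the letters, read from the end of w, are
true; so w leaves the path to x at height h - trues w. *)
Definition trues (w : seq bool) := find negb (rev w).

Lemma trues_rcons w b : trues (rcons w b) = if b then (trues w).+1 else 0.
Proof. by rewrite /trues rev_rcons; case: b. Qed.

Lemma trues_size w : trues w <= size w.
Proof. by rewrite /trues -[size w]size_rev find_size. Qed.

Lemma trues_cons b w :
  trues (b :: w) = if trues w == size w then trues w + b else trues w.
Proof.
rewrite /trues rev_cons -cats1 find_cat -[size w]size_rev has_find.
by case: ltngtP (find_size negb (rev w)) => // -> _; case: b.
Qed.

(** The sum of F over the vertices whose lowest common ancestor with x is x_k:
x_k itself, and the side branch at x_k, which is a complete binary tree of
height k - 1 with 2 ^ (k - 1 - j) vertices at height j. *)
Definition shell (M : nmodType) (F : nat -> nat -> M) k : M :=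
  (F k k + \sum_(j < k) F k j *+ 2 ^ (k.-1 - j))%R.

Lemma sum_words_size (M : nmodType) (G : nat -> M) h :
  (\sum_(w <- words h) G (h - size w)%N = \sum_(j < h.+1) G j *+ 2 ^ (h - j))%R.
Proof.
elim: h => [|h IHh] /=; first by rewrite big_seq1 big_ord1.
rewrite big_cons big_cat !big_map /=.
have szE b : (\sum_(w <- words h) G (h.+1 - size (rcons w b))%N =
              \sum_(w <- words h) G (h - size w)%N)%R.
  by apply: eq_bigr => w _; rewrite size_rcons subSS.
rewrite !szE IHh [RHS]big_ord_recr /= subnn subn0 mulr1n addrC; congr (_ + _)%R.
rewrite -big_split; apply: eq_bigr => j _ /=.
by rewrite -mulrnDr addnn -mul2n -expnS -subSn // -ltnS.
Qed.

Lemma sum_words_shell (M : nmodType) (F : nat -> nat -> M) h :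
  (\sum_(w <- words h) F (h - trues w)%N (h - size w)%N =
   \sum_(k < h.+1) shell F k)%R.
Proof.
elim: h => [|h IHh].
  by rewrite /= big_seq1 big_ord1 /shell big_ord0 addr0.
rewrite big_ord_recr -IHh /= big_cons big_cat !big_map /=.
rewrite addrCA; congr (_ + _)%R.
  by apply: eq_bigr => w _; rewrite trues_rcons size_rcons !subSS.
rewrite /shell; congr (_ + _)%R.
rewrite -(sum_words_size (F h.+1)).
by apply: eq_bigr => w _; rewrite trues_rcons size_rcons subSS subn0.
Qed.

(** * The weights *)

Fixpoint fib n : nat :=
  if n is n'.+1 then if n' is n''.+1 then fib n' + fib n'' else 1 else 0.
Arguments fib : simpl never.

Lemma fibSS n : fib n.+2 = fib n.+1 + fib n.
Proof. by []. Qed.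

Lemma leq_fibS n : fib n <= fib n.+1.
Proof. by case: n => [//|n]; rewrite fibSS leq_addr. Qed.

(** The bound 5/8 is attained at 5/8 = F_5/F_6, and it passes from two
consecutive indices to the next by addition; starting at F_4/F_5 excludes
F_3/F_4 = 2/3. *)
Lemma fib_ratio n : 8 * fib n.+4 <= 5 * fib n.+4.+1.
Proof.
suff: (8 * fib n.+4 <= 5 * fib n.+4.+1) && (8 * fib n.+4.+1 <= 5 * fib n.+4.+2).
  by case/andP.
elim: n => [//|n /andP[le0 le1]]; rewrite le1 andTb.
rewrite (fibSS n.+4.+1) mulnDr {1}(fibSS n.+4) mulnDr.
exact: leq_add le1 le0.
Qed.

Local Open Scope ring_scope.

(** The geometric part starts at k = 5, where [fib_ratio] applies.  The earlier
values come from it by going backwards: the weight p_(k-1) of x_(k-1) is taken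
as large as [wt_path] permits, the minimum of p_k + p_(k+1) and, for k >= 2,
p_k + scale k * F_(k-1).  This gives the path weights
30, 48, 78, 117, 195, 312 for k = 5, 4, 3, 2, 1, 0. *)
Definition scale k : rat :=
  nth (6 * (5 / 13) ^+ (k - 5)) [:: 0; 195; 117; 39; 16] k.

(** The rule scale k * F_j would give 0 to the two leaves x, with coordinates
(0, 0), and its sibling, with coordinates (1, 0).  The sibling needs
312 - 195 = 117, since a peg on it can jump over x_1 into x. *)
Definition wt k j : rat :=
  if j is 0%N then nth 0 [:: 312; 117] k else scale k * (fib j)%:R.

Arguments wt : simpl never.

Lemma scale_geom k : scale k.+4.+1 = 6 * (5 / 13) ^+ k.
Proof. by rewrite /scale nth_default // !subSS subn0. Qed.

Lemma scale_step k : scale k.+4.+2 = 5 / 13 * scale k.+4.+1.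
Proof. by rewrite !scale_geom exprS mulrCA. Qed.

Lemma scale_ge0 k : 0 <= scale k.
Proof.
case: k => [|[|[|[|[|k]]]]]; try by rewrite /scale /= ?lexx ?ler0n.
by rewrite scale_geom mulr_ge0 ?exprn_ge0 ?divr_ge0 ?ler0n.
Qed.

Lemma wt_ge0 k j : 0 <= wt k j.
Proof.
case: j => [|j]; first by case: k => [|[|k]]; rewrite /wt /= ?nth_nil ?ler0n.
by rewrite mulr_ge0 ?scale_ge0.
Qed.

Lemma wt_fib k j : (1 < k)%N -> wt k j = scale k * (fib j)%:R.
Proof. by case: j => // lt1k; rewrite mulr0 /wt nth_default. Qed.

(** The neighbours of a vertex at height j + 1 inside a side branch have heights
j + 2 and j, so this is the Fibonacci recurrence. *)
Lemma wt_side k j : (j.+1 < k)%N ->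
  {in [:: wt k j.+2; wt k j] &, forall a b, b <= a + wt k j.+1}.
Proof.
move=> lt_jk; rewrite !wt_fib ?(leq_trans _ lt_jk) // fibSS natrD mulrDr.
have c_ge0 := scale_ge0 k.
have x_ge0 : 0 <= scale k * (fib j)%:R by rewrite mulr_ge0.
have y_ge0 : 0 <= scale k * (fib j.+1)%:R by rewrite mulr_ge0.
by move=> a b; rewrite !inE => /orP[]/eqP-> /orP[]/eqP->; lra.
Qed.

(** The inequalities at x_k for k >= 6, with x = F_k, y = F_(k-1) and
c = scale (k - 1).  The last two both amount to y / x <= 5/8. *)
Lemma geom_step (R : realFieldType) (c x y : R) :
  0 <= c -> 0 <= y -> y <= x -> 8 * y <= 5 * x ->
  5 / 13 * (5 / 13 * c) * (x + y) <= 5 / 13 * c * x /\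
  5 / 13 * c * y <= 5 / 13 * c * x /\
  c * y <= 5 / 13 * (5 / 13 * c) * (x + y) + 5 / 13 * c * x /\
  c * y <= 5 / 13 * c * y + 5 / 13 * c * x.
Proof.
move=> c_ge0 y_ge0 le_yx le_8y5x.
have := mulr_ge0 c_ge0 y_ge0.
have : 0 <= c * (x - y) by rewrite mulr_ge0 ?subr_ge0.
have : 0 <= c * (5 * x - 8 * y) by rewrite mulr_ge0 ?subr_ge0.
by move=> *; do !split; lra.
Qed.

(** The neighbours of x_k are x_(k+1), x_(k-1) and the top of the side branch.
The weights of x_(k+1) and of that top do not exceed the weight of x_k, so only
jumps towards the target, into x_(k-1), are critical.  For k = 0 the second
and third entries are the weight of x itself. *)
Lemma wt_path k :
  {in [:: wt k.+1 k.+1; wt k.-1 k.-1; wt k k.-1] &,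
   forall a b, b <= a + wt k k}.
Proof.
suff [p_decr [s_le [step2 step1]]]:
    wt k.+1 k.+1 <= wt k k /\ wt k k.-1 <= wt k k /\
    wt k.-1 k.-1 <= wt k.+1 k.+1 + wt k k /\
    wt k.-1 k.-1 <= wt k k.-1 + wt k k.
  have := wt_ge0 k.+1 k.+1; have := wt_ge0 k.-1 k.-1; have := wt_ge0 k k.-1.
  move=> ? ? ?.
  by move=> a b; rewrite !inE => /or3P[]/eqP-> /or3P[]/eqP->; lra.
have scale5 : scale 5 = 6 by rewrite (scale_geom 0) expr0 mulr1.
have scale6 : scale 6 = 30 / 13 by rewrite (scale_geom 1) expr1; lra.
(* Up to k = 5 the inequalities are numerical; the tightest are equalities. *)
case: k => [|[|[|[|[|[|k]]]]]].
1-6: rewrite /wt /= ?scale5 ?scale6 /scale /= /fib /=.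
1-6: by rewrite ?natrD; do !split; lra.
have wtE m j : wt m.+2 j = scale m.+2 * (fib j)%:R by rewrite wt_fib.
rewrite !wtE.
rewrite (scale_step k.+1) (scale_step k).
have := scale_ge0 k.+4.+1; move: (scale _) => c c_ge0.
have := fib_ratio k.+1; have := leq_fibS k.+4.+1.
rewrite (fibSS k.+4.+1) natrD.
move: (fib k.+4.+2) (fib k.+4.+1) => x y.
rewrite -!(ler_nat rat) !natrM => le_yx le_8y5x.
exact: geom_step (ler0n _ y) _ _.
Qed.

(** * The weights form a pagoda function *)

Definition word_wt h (w : seq bool) : rat := wt (h - trues w) (h - size w).

Lemma path_neighbour h (u v : btree h) : trues v = size v -> btree_adj u v ->
  word_wt h u \in [:: wt (h - size v).+1 (h - size v).+1;
                      wt (h - size v).-1 (h - size v).-1;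
                      wt (h - size v) (h - size v).-1].
Proof.
rewrite /word_wt !inE => tv /orP[]/existsP[b /eqP def].
  have := trues_size u; have := size_bseq v; move: tv.
  rewrite {}def trues_cons /= => tv lt_uh le_tu.
  have -> : trues u = size u by case: eqP tv => // _ tv; lia.
  by rewrite subnSK // eqxx.
rewrite def trues_cons tv eqxx /= subnS; case: b {def} => /=.
  by rewrite addn1 subnS eqxx orbT.
by rewrite addn0 eqxx !orbT.
Qed.

Lemma side_neighbour h (u v : btree h) :
    (trues v < size v)%N -> btree_adj u v -> (size v < h)%N ->
  word_wt h u \in [:: wt (h - trues v) (h - size v).+1;
                      wt (h - trues v) (h - (size v).+1)].
Proof.
rewrite /word_wt !inE => lt_tv /orP[]/existsP[b /eqP def] lt_vh; last first.
  by rewrite def trues_cons (ltn_eqF lt_tv) /= eqxx orbT.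
move: lt_tv lt_vh; rewrite {}def trues_cons /=; case: (trues u =P _) => [->|_].
  case: b => lt_tv lt_uh; first by rewrite addn1 ltnn in lt_tv.
  by rewrite addn0 subnSK ?eqxx // ltnW.
by move=> lt_tv lt_uh; rewrite subnSK ?eqxx // ltnW.
Qed.

(** A leaf off the path can be weightless because its parent is its only
neighbour, so that no peg jumps over it. *)
Lemma btree_pagoda h : pagoda (@btree_adj h) (fun w : btree h => word_wt h w).
Proof.
split=> [w|u v w adj_uv adj_wv neq_uw]; first exact: wt_ge0.
have le_tv := trues_size v; have le_vh := size_bseq v.
case: (ltngtP (trues v) (size v)) le_tv => // [lt_tv|tv] _; last first.
  have -> : word_wt h v = wt (h - size v) (h - size v) by rewrite /word_wt tv.
  by apply: wt_path; apply: path_neighbour.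
case: (ltngtP (size v) h) le_vh => // [lt_vh|eq_vh] _; last first.
  case/negP: neq_uw; apply/eqP.
  have up y : btree_adj y v -> btree_child y v.
    case/orP=> // /existsP[b /eqP def].
    by have := size_bseq y; rewrite def /= eq_vh ltnn.
  have [|p [_ pP]] := @btree_parent_unique h v.
    by case: (val v) lt_tv.
  by rewrite -(pP u) ?(pP w) ?up.
have := wt_side (k := h - trues v) (j := h - (size v).+1).
rewrite subnSK //; apply; [|exact: side_neighbour..].
by rewrite ltn_sub2l // (ltn_trans lt_tv).
Qed.

(** * The holes *)

Lemma shell_fib k :
  shell (fun _ j => (fib j)%:R) k = 2 ^+ k - (fib k.+1)%:R :> rat.
Proof.
elim: k => [|k IHk]; first by rewrite /shell big_ord0 /fib /= addr0 subrr.
have sumE : \sum_(j < k) ((fib j)%:R : rat) *+ 2 ^ (k.-1 - j) =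
    2 ^+ k - (fib k.+1)%:R - (fib k)%:R.
  by rewrite -IHk /shell [RHS]addrAC subrr add0r.
rewrite /shell big_ord_recr /= subnn.
under eq_bigr => j _.
  have -> : (k - j)%N = (k.-1 - j).+1 by have := ltn_ord j; lia.
  rewrite expnS mulnC mulrnA.
over.
rewrite sumrMnl sumE exprS (fibSS k) natrD mulr2n; ring.
Qed.

(** Roughly the heaviest vertices: x, its sibling and x_1; all vertices of
positive weight in the subtree of x_7; in the subtree of x_8, those at height
at least 3. *)
Definition hole k j : bool :=
  [|| k <= 1, (0 < j) && (k <= 7) | (2 < j) && (k == 8)]%N.

Lemma hole_large k j : (8 < k)%N -> hole k j = false.
Proof.
move=> lt8k; rewrite /hole (gtn_eqF lt8k) andbF orbF.
by rewrite (leqNgt k 1) (leqNgt k 7) !(leq_trans _ lt8k) //= andbF.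
Qed.

Lemma sum_holes n :
  (\sum_(k < n) shell (fun k j => (hole k j : nat)) k <= 161)%N.
Proof.
have shell0 k : (8 < k)%N -> shell (fun k j => (hole k j : nat)) k = 0%N.
  move=> lt8k; rewrite /shell hole_large // big1 // => j _.
  by rewrite hole_large // mul0rn.
have le_sum m : (\sum_(k < m) shell (fun k j => (hole k j : nat)) k <=
                 \sum_(k < m + 9) shell (fun k j => (hole k j : nat)) k)%N.
  by rewrite big_split_ord /= leq_addr.
apply: leq_trans (le_sum n) _; rewrite addnC big_split_ord /=.
rewrite [X in (_ + X)%N]big1 => [|k _]; last by rewrite shell0 // leq_addr.
by rewrite /shell !big_ord_recr !big_ord0.
Qed.

Definition peg_wt k j : rat := if hole k j then 0 else wt k j.

Lemma shell_peg_small k : (k <= 7)%N -> shell peg_wt k = 0.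
Proof.
move=> le_k7; have peg0 j : peg_wt k j = 0.
  rewrite /peg_wt /hole le_k7 andbT; case: j => [|j]; last by rewrite orbT.
  rewrite !orbF; case: leqP => // lt1k.
  by rewrite wt_fib // mulr0.
by rewrite /shell peg0 big1 ?addr0 // => j _; rewrite peg0 mul0rn.
Qed.

Lemma shell_peg8 : shell peg_wt 8 = 96 * scale 8.
Proof.
rewrite /shell !big_ord_recr big_ord0 /= /peg_wt /hole /= /wt /=.
rewrite /fib /=.
move: (scale 8) => c.
rewrite !mul0rn !add0r !addr0 addn0 mulr1 -mulrnDr.
by rewrite mulr_natl.
Qed.

Lemma shell_peg_large k : (8 < k)%N ->
  shell peg_wt k = scale k * (2 ^+ k - (fib k.+1)%:R).
Proof.
move=> lt8k; rewrite -shell_fib /shell.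
have pegE j : peg_wt k j = scale k * (fib j)%:R.
  by rewrite /peg_wt hole_large // wt_fib // (leq_trans _ lt8k).
rewrite mulrDr mulr_sumr pegE; congr (_ + _).
by apply: eq_bigr => j _; rewrite pegE [RHS]mulrnAr.
Qed.

(** The sum of scale k * (2 ^ k - F_(k+1)) over all k >= n + 5: a geometric
series of ratio 10/13 (13/3 is 1 / (1 - 10/13)) minus a Fibonacci series
(169/79 is 1 / (1 - q - q ^ 2) for q = 5/13). *)
Definition tail_wt n : rat :=
  6 * (5 / 13) ^+ n *
  (13 / 3 * 2 ^+ n.+4.+1 -
   169 / 79 * ((fib n.+4.+2)%:R + 5 / 13 * (fib n.+4.+1)%:R)).

Lemma tail_wt_step n :
  tail_wt n = scale n.+4.+1 * (2 ^+ n.+4.+1 - (fib n.+4.+2)%:R) + tail_wt n.+1.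
Proof.
rewrite /tail_wt scale_geom (fibSS n.+4.+1) natrD !exprS.
move: (fib _)%:R (fib _)%:R => x y; move: (2 ^+ n) (_ ^+ n) => a b.
by field.
Qed.

Lemma fib_exp n : (fib n.+1 <= 2 ^ n)%N.
Proof.
elim: n => // n IHn; rewrite fibSS expnS mul2n -addnn leq_add //.
exact: leq_trans (leq_fibS n) IHn.
Qed.

Lemma tail_wt_ge0 n : 0 <= tail_wt n.
Proof.
apply: mulr_ge0; first by rewrite mulr_ge0 ?exprn_ge0 ?divr_ge0 ?ler0n.
have := fib_exp n.+4.+1; have := leq_fibS n.+4.+1.
rewrite -!(ler_nat rat) natrX; have := ler0n rat (fib n.+4.+1).
lra.
Qed.

(** The pegs with k = 8 weigh 96 * scale 8 < 33, those with k >= 9 weigh at most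
tail_wt 4 < 273; smaller k contribute nothing. *)
Lemma sum_pegs n : \sum_(k < n) shell peg_wt k < 312.
Proof.
pose S n := \sum_(k < n) shell peg_wt k.
have S9 : S 9%N + tail_wt 4 < 312.
  rewrite /S big_ord_recr /= big1 => [|k _]; last first.
    by rewrite shell_peg_small // -ltnS.
  rewrite add0r shell_peg8 (scale_geom 3) /tail_wt /fib /=; lra.
have Stail m : S (9 + m)%N + tail_wt (4 + m) < 312.
  elim: m => [|m IHm]; first by rewrite !addn0.
  move: IHm; rewrite tail_wt_step addrA !addnS.
  by rewrite {2}/S big_ord_recr /= shell_peg_large.
case: (leqP 9 n) => [/subnKC <-|lt_n9].
  by apply: le_lt_trans (Stail (n - 9)%N); rewrite lerDl tail_wt_ge0.
rewrite big1 ?ltr0n // => k _; rewrite shell_peg_small //.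
by rewrite -ltnS (leq_trans (ltn_ord k)) // ltnW.
Qed.

Lemma btree_unreached_leaf h : exists (A : {set btree h}) (x : btree h),
  (#|btree h| - 161 <= #|A|)%N /\
  weight (fun w : btree h => word_wt h w) A < word_wt h x.
Proof.
pose hole_at (w : btree h) := hole (h - trues w) (h - size w).
have szx : (size (nseq h true) <= h)%N by rewrite size_nseq.
exists [set w | ~~ hole_at w], (Bseq szx); split.
  rewrite -(cardsC [set w | hole_at w]) leq_subLR.
  have -> : ~: [set w | hole_at w] = [set w | ~~ hole_at w].
    by apply/setP=> w; rewrite !inE.
  rewrite leq_add2r cardsE -sum1_card big_mkcond /=.
  rewrite (big_btree h (fun w => (hole (h - trues w) (h - size w) : nat))).
  by rewrite (sum_words_shell (fun k j => (hole k j : nat))) sum_holes.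
have -> : word_wt h (Bseq szx) = 312.
  rewrite /word_wt /trues /= rev_nseq size_nseq subnn.
  suff /eqP : find negb (nseq h true) == h by move->; rewrite subnn.
  by rewrite -[X in _ == X](size_nseq h true) eq_sym hasNfind // has_nseq andbF.
apply: le_lt_trans (sum_pegs h.+1).
rewrite -sum_words_shell.
rewrite -(big_btree h (fun w => peg_wt (h - trues w) (h - size w))).
rewrite /weight big_mkcond /= le_eqVlt; apply/orP; left; apply/eqP.
by apply: eq_bigr => w _; rewrite inE /peg_wt -/(hole_at w) if_neg.
Qed.

Local Close Scope ring_scope.

Theorem corollary4p4 (h : nat) :
  #|btree h| - 172 <= pegging_number (@btree_adj h).
Proof.
have [A [x [leA ltAx]]] := btree_unreached_leaf h.
apply: leq_trans (ltnW (pagoda_lt_pegging_number (btree_pagoda h) ltAx)).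
exact: leq_trans (leq_sub2l _ _) leA.
Qed.
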